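(* Let $\mathbb F$ be a field of characteristic $0$ and let $r\in\mathcal R_{\mathbb F}(\underline z)$ be a noncommutative rational expression that admits a realization of dimension $n$ about a point in $M_m(\mathbb F)^g$. If $r$ vanishes on $\operatorname{dom}_Nr$ for $N=m\left\lceil\tfrac{mn}{2}\right\rceil$, then $r$ is a rational identity.
   Context: Rational expressions: $\mathcal R_{\mathbb F}(\underline z)$ is the set of syntactically valid combinations of noncommutative polynomials over $\mathbb F$ in $\underline z=\{z_1,\dots,z_g\}$, operations $+,\cdot,{}^{-1}$ and parentheses. For $\underline a\in M_m(\mathbb F)^g$, $r(\underline a)$ is obtained by replacing $z_j$ by $a_j$ and $1$ by $I_m$; $\operatorname{dom}_m r\subseteq M_m(\mathbb F)^g$ is the set of $\underline a$ at which all inverses occurring in $r$ exist; $\operatorname{dom}r=\bigcup_m\operatorname{dom}_mr$. If $\operatorname{dom}r\neq\emptyset$ and $r(\underline a)=0$ for all $\underline a\in\operatorname{dom}r$, then $r$ is called a rational identity. Realizations: let $\mathcal A=M_m(\mathbb F)$, let $\underline x=\{x_1,\dots,x_g\}$ be freely noncommuting letters, $\mathcal A\langle\underline x\rangle=\mathcal A*_{\mathbb F}\mathbb F\langle\underline x\rangle$, with $(\underline x)$-adic completion $\mathcal A\langle\!\langle\underline x\rangle\!\rangle$. For a word $w=w_1\cdots w_\ell$, $\mathcal A^w$ is the $\mathbb F$-span of all $a_0w_1a_1\cdots w_\ell a_\ell$, $a_i\in\mathcal A$; every series is uniquely $S=\sum_w[S,w]$, $[S,w]\in\mathcal A^w$.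 For $\underline p\in\operatorname{dom}_mr$, a realization of $r$ of dimension $n\in\mathbb N$ about $\underline p$ is a triple $(\mathbf c,A,\mathbf b)$ with $\mathbf c\in\mathcal A^{1\times n}$, $\mathbf b\in\mathcal A^{n\times1}$, $A^{x}\in(\mathcal A^{x})^{n\times n}$ for $x\in\underline x$, such that the expansion $S=r(x_1+p_1,\dots,x_g+p_g)\in\mathcal A\langle\!\langle\underline x\rangle\!\rangle$ satisfies $[S,w]=\mathbf cA^w\mathbf b$ for all words $w$, where $A^w=A^{w_1}\cdots A^{w_{|w|}}$. *)

(* Defs.v *)
From HB Require Import structures.
From mathcomp Require Import all_boot all_order all_algebra.
From mathcomp Require Import boolp.

Set Implicit Arguments.
Unset Strict Implicit.
Unset Printing Implicit Defensive.

Import GRing.Theory.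
Local Open Scope ring_scope.

(* Noncommutative rational expressions over F in g letters. Polynomials are
   built from RConst, RVar, RAdd and RMul; - r is RMul (RConst (-1)) r. *)
Inductive rexpr (F : Type) (g : nat) : Type :=
| RConst of F
| RVar of 'I_g
| RAdd of rexpr F g & rexpr F g
| RMul of rexpr F g & rexpr F g
| RInv of rexpr F g.

Arguments RConst {F g}.
Arguments RVar {F g}.

Section MatrixEvaluation.
Variables (F : fieldType) (g m : nat) (a : 'I_g -> 'M[F]_m).

(* Only meaningful on rdom, since invmx is the identity on singular matrices. *)
Fixpoint reval (r : rexpr F g) : 'M[F]_m :=
  match r with
  | RConst c => c%:M
  | RVar j => a j
  | RAdd r1 r2 => reval r1 + reval r2
  | RMul r1 r2 => reval r1 *m reval r2
  | RInv r1 => invmx (reval r1)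
  end.

Fixpoint rdom (r : rexpr F g) : bool :=
  match r with
  | RConst _ | RVar _ => true
  | RAdd r1 r2 | RMul r1 r2 => rdom r1 && rdom r2
  | RInv r1 => rdom r1 && (reval r1 \in unitmx)
  end.

End MatrixEvaluation.

(* Sizes are positive: 0 x 0 matrices would put a point in every domain. *)
Definition rational_identity (F : fieldType) (g : nat) (r : rexpr F g) : Prop :=
  (exists m : nat, (0 < m)%N /\ exists a : 'I_g -> 'M[F]_m, rdom a r) /\
  (forall (m : nat) (a : 'I_g -> 'M[F]_m),
     (0 < m)%N -> rdom a r -> reval a r = 0).

(* The completed free product A<<x>> of A = M_m(F) with F<x>, x = x_1..x_g.

   The elements  E_(i,j0) x_k1 E_(i1,j1) x_k2 ... x_kl E_(il,j),  with E_(_,_)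
   the matrix units of A, form an F-basis of A^w for w = x_k1 ... x_kl, so that
   a series is an arbitrary family of coefficients in this basis. The basis
   element above is recorded as the entry (i, j) of the coefficient at
     s = [:: (j0, k1, i1); (j1, k2, i2); ...; (j(l-1), kl, il)].
   Since E_(i,j) E_(i',j') = (j == i') E_(i,j'), the product becomes the Cauchy
   product with matrix multiplication of the coefficients. *)
Notation gword m g := (seq ('I_m * 'I_g * 'I_m)).

Definition gletters (m g : nat) (s : gword m g) : seq 'I_g :=
  [seq t.1.2 | t <- s].

Record series (F : fieldType) (m g : nat) : Type :=
  Series { coef :> gword m g -> 'M[F]_m }.

HB.instance Definition _ (F : fieldType) (m g : nat) :=
  gen_eqMixin (series F m g).
HB.instance Definition _ (F : fieldType) (m g : nat) :=
  gen_choiceMixin (series F m g).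

Section SeriesRing.
Variables (F : fieldType) (m g : nat).
Implicit Types (S T U : series F m g) (a : 'M[F]_m) (s : gword m g).

Lemma seriesP S T : S =1 T -> S = T.
Proof. by case: S T => [S] [T] /= /funext ->. Qed.

Definition ser_cst a : series F m g := Series (fun s => if s is [::] then a else 0).
Definition ser_opp S : series F m g := Series (fun s => - S s).
Definition ser_add S T : series F m g := Series (fun s => S s + T s).
Definition ser_mul S T : series F m g :=
  Series (fun s => \sum_(k < (size s).+1) S (take k s) *m T (drop k s)).

Definition ser_shift t S : series F m g := Series (fun s => S (t :: s)).

Lemma ser_mul_nil S T : ser_mul S T [::] = S [::] *m T [::].
Proof. by rewrite /= big_ord1. Qed.

Lemma ser_mul_cons S T t s :
  ser_mul S T (t :: s) = S [::] *m T (t :: s) + ser_mul (ser_shift t S) T s.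
Proof. by rewrite /= big_ord_recl. Qed.

Lemma ser_mulDl : left_distributive ser_mul ser_add.
Proof.
move=> S T U; apply: seriesP => s /=.
by rewrite -big_split /=; apply: eq_bigr => k _; rewrite mulmxDl.
Qed.

Lemma ser_mulDr : right_distributive ser_mul ser_add.
Proof.
move=> S T U; apply: seriesP => s /=.
by rewrite -big_split /=; apply: eq_bigr => k _; rewrite mulmxDr.
Qed.

Lemma ser_mul0 T s : ser_mul (ser_cst 0) T s = 0.
Proof. by rewrite /= big1 // => k _; case: take => [|? ?]; rewrite mul0mx. Qed.

Lemma ser_mulcl a T s : ser_mul (ser_cst a) T s = a *m T s.
Proof.
case: s => [|t s]; first exact: ser_mul_nil.
rewrite ser_mul_cons; have -> : ser_shift t (ser_cst a) = ser_cst 0.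
  by apply: seriesP => -[].
by rewrite ser_mul0 addr0.
Qed.

Lemma ser_mulA : associative ser_mul.
Proof.
move=> S T U; apply: seriesP => s; elim: s S T => [|t s IHs] S T.
  by rewrite !ser_mul_nil mulmxA.
have shiftM : ser_shift t (ser_mul S T) =
    ser_add (ser_mul (ser_cst (S [::])) (ser_shift t T))
            (ser_mul (ser_shift t S) T).
  apply: seriesP => s'; rewrite -[LHS]/(ser_mul S T (t :: s')).
  rewrite -[RHS]/(ser_mul (ser_cst (S [::])) (ser_shift t T) s' +
                  ser_mul (ser_shift t S) T s').
  by rewrite ser_mul_cons ser_mulcl.
rewrite [RHS]ser_mul_cons shiftM ser_mulDl ser_mul_nil ser_mul_cons IHs.
rewrite ser_mul_cons mulmxDr mulmxA -addrA; congr (_ + _).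
rewrite -[RHS]/(ser_mul (ser_mul _ _) _ s + ser_mul (ser_mul _ _) _ s).
by rewrite -!IHs ser_mulcl.
Qed.

Lemma ser_mul1l : left_id (ser_cst 1%:M) ser_mul.
Proof. by move=> S; apply: seriesP => s; rewrite ser_mulcl mul1mx. Qed.

Lemma ser_mul1r : right_id (ser_cst 1%:M) ser_mul.
Proof.
move=> S; apply: seriesP => s /=; rewrite big_ord_recr /= take_size drop_size.
rewrite mulmx1 big1 ?add0r // => k _.
by case E: (drop k s) => [|u v]; [move: (ltn_ord k); rewrite -subn_gt0 -size_drop E | rewrite mulmx0].
Qed.

Lemma ser_addA : associative ser_add.
Proof. by move=> S T U; apply: seriesP => s; apply: addrA. Qed.

Lemma ser_addC : commutative ser_add.
Proof. by move=> S T; apply: seriesP => s; apply: addrC. Qed.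

Lemma ser_add0 : left_id (ser_cst 0) ser_add.
Proof. by move=> S; apply: seriesP => -[|t s]; apply: add0r. Qed.

Lemma ser_addN : left_inverse (ser_cst 0) ser_opp ser_add.
Proof. by move=> S; apply: seriesP => -[|t s]; apply: addNr. Qed.

HB.instance Definition _ := GRing.isPzRing.Build (series F m g)
  ser_addA ser_addC ser_add0 ser_addN
  ser_mulA ser_mul1l ser_mul1r ser_mulDl ser_mulDr.

(* x_k = sum_(i, j) E_(i,i) x_k E_(j,j). *)
Definition ser_var (k : 'I_g) : series F m g :=
  Series (fun s => if s is [:: (i, k', j)] then
                     if k' == k then delta_mx i j else 0
                   else 0).

(* a_0 w_1 a_1 ... w_l a_l for u = [:: (w_1, a_1); ...; (w_l, a_l)]. *)
Definition ser_mono (a0 : 'M[F]_m) (u : seq ('I_g * 'M[F]_m)) : series F m g :=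
  ser_cst a0 * \prod_(t <- u) (ser_var t.1 * ser_cst t.2).

(* A^w as a span; scalars are absorbed by a_0. *)
Definition in_Aw (w : seq 'I_g) (S : series F m g) : Prop :=
  exists2 l : seq ('M[F]_m * seq ('I_g * 'M[F]_m)),
    all (fun t => unzip1 t.2 == w) l & S = \sum_(t <- l) ser_mono t.1 t.2.

(* The component [S, w]; by in_AwP it is the unique element of A^w that agrees
   with S on the basis of A^w. *)
Definition ser_comp (S : series F m g) (w : seq 'I_g) : series F m g :=
  Series (fun s => if gletters s == w then S s else 0).

Lemma ser_coefD S T s : (S + T) s = S s + T s. Proof. by []. Qed.

Lemma ser_coef0 s : (0 : series F m g) s = 0. Proof. by case: s. Qed.

Lemma ser_coef_sum (I : Type) (r : seq I) (P : pred I) (G : I -> series F m g) s :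
  (\sum_(i <- r | P i) G i) s = \sum_(i <- r | P i) G i s.
Proof.
by elim/big_rec2: _ => [|i y1 y2 _ <-]; rewrite ?ser_coef0 ?ser_coefD.
Qed.

Lemma ser_cstMl a S s : (ser_cst a * S) s = a *m S s.
Proof. exact: ser_mulcl. Qed.

Lemma ser_cstM a b : ser_cst (a *m b) = ser_cst a * ser_cst b :> series F m g.
Proof.
by apply: seriesP => -[|t s]; rewrite ser_cstMl //= mulmx0.
Qed.

Lemma ser_varMl k S s :
  (ser_var k * S) s =
  if s is (i, k', j) :: s' then if k' == k then delta_mx i j *m S s' else 0
  else 0.
Proof.
case: s => [|[[i k'] j] s].
  by rewrite -[LHS]/(ser_mul (ser_var k) S [::]) ser_mul_nil mul0mx.
rewrite -[LHS]/(ser_mul (ser_var k) S (_ :: s)) ser_mul_cons mul0mx add0r.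
have -> : ser_shift (i, k', j) (ser_var k) =
          ser_cst (if k' == k then delta_mx i j else 0) by apply: seriesP => -[].
by rewrite ser_mulcl; case: eqP => //; rewrite mul0mx.
Qed.

Lemma ser_mono_cons a0 t u :
  ser_mono a0 (t :: u) = ser_cst a0 * ser_var t.1 * ser_mono t.2 u.
Proof. by rewrite /ser_mono big_cons !mulrA. Qed.

Lemma ser_mono_eq0 a0 u s : gletters s != unzip1 u -> ser_mono a0 u s = 0.
Proof.
elim: u a0 s => [|[k a] u IHu] a0 s su.
  by rewrite /ser_mono big_nil ser_cstMl; case: s su => // t s _; rewrite mulmx0.
rewrite ser_mono_cons -mulrA ser_cstMl ser_varMl.
case: s su => [|[[i k'] j] s] su; first by rewrite mulmx0.
case: eqP => [kk|_]; last by rewrite mulmx0.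
by rewrite IHu ?mulmx0 //; apply: contraNneq su => /= ->; rewrite kk.
Qed.

Lemma in_AwP w S :
  in_Aw w S <-> (forall s, gletters s != w -> S s = 0).
Proof.
split=> [[l /allP lw ->] s sw|].
  rewrite ser_coef_sum big_seq big1 // => t /lw /eqP tw.
  by rewrite ser_mono_eq0 // tw.
elim: w S => [|k w IHw] S Sw.
  exists [:: (S [::], [::])] => //; rewrite big_seq1 /ser_mono big_nil mulr1.
  by apply: seriesP => -[|t s] //; rewrite Sw.
have sum0 l0 : in_Aw l0 0 by exists [::]; rewrite ?big_nil.
have sumD l0 T U : in_Aw l0 T -> in_Aw l0 U -> in_Aw l0 (T + U).
  case=> [l1 l1P ->] [l2 l2P ->]; exists (l1 ++ l2); last by rewrite big_cat.
  by rewrite all_cat l1P.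
have step a b T : in_Aw w T ->
    in_Aw (k :: w) (ser_cst a * ser_var k * (ser_cst b * T)).
  case=> [l lP ->]; exists [seq (a, (k, b *m t.1) :: t.2) | t <- l].
    by rewrite all_map; apply: sub_all lP => t /= /eqP ->.
  rewrite big_map !mulr_sumr; apply: eq_bigr => t _.
  by rewrite ser_mono_cons /= /ser_mono ser_cstM !mulrA.
have -> : S = \sum_(x < m) \sum_(i < m) \sum_(j < m)
    ser_cst (delta_mx x i) * ser_var k *
      (ser_cst (delta_mx j x) * ser_shift (i, k, j) S).
  apply: seriesP => s.
  have -> : (\sum_(x < m) \sum_(i < m) \sum_(j < m)
      ser_cst (delta_mx x i) * ser_var k *
        (ser_cst (delta_mx j x) * ser_shift (i, k, j) S)) s =
    \sum_(x < m) \sum_(i < m) \sum_(j < m)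
      delta_mx x i *m
        (ser_var k * (ser_cst (delta_mx j x) * ser_shift (i, k, j) S)) s.
    rewrite ser_coef_sum; apply: eq_bigr => x _.
    rewrite ser_coef_sum; apply: eq_bigr => i _.
    rewrite ser_coef_sum; apply: eq_bigr => j _.
    by rewrite -mulrA ser_cstMl.
  case: s => [|[[i0 k0] j0] s].
    rewrite Sw // big1 // => x _; rewrite big1 // => i _; rewrite big1 // => j _.
    by rewrite ser_varMl mulmx0.
  have [->|kk] := eqVneq k0 k; last first.
    rewrite Sw; last by apply: contraNneq kk => -[->].
    rewrite big1 // => x _; rewrite big1 // => i _; rewrite big1 // => j _.
    by rewrite ser_varMl (negPf kk) mulmx0.
  have sum1E : \sum_(x < m) delta_mx x x = 1%:M :> 'M[F]_m.
    by rewrite -diag_const_mx diag_mx_sum_delta; apply: eq_bigr => x _;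
       rewrite mxE scale1r.
  rewrite -[LHS]mul1mx -sum1E mulmx_suml; apply: eq_bigr => x _.
  rewrite (bigD1 i0) // -[RHS]/(_ + _) [X in _ + X]big1 => [|i /andP[_ ii0]].
    rewrite addr0 (bigD1 j0) // -[RHS]/(_ + _) [X in _ + X]big1 => [|j /andP[_ jj0]].
      by rewrite addr0 ser_varMl eqxx ser_cstMl !mulmxA !mul_delta_mx.
    by rewrite ser_varMl eqxx ser_cstMl !mulmxA mul_delta_mx
               mul_delta_mx_0 1?eq_sym ?mul0mx.
  rewrite big1 // => j _.
  by rewrite ser_varMl eqxx mulmxA mul_delta_mx_0 ?mul0mx.
apply: (big_ind (in_Aw (k :: w))) => // [|x _]; first exact: sumD.
apply: (big_ind (in_Aw (k :: w))) => // [|i _]; first exact: sumD.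
apply: (big_ind (in_Aw (k :: w))) => // [|j _]; first exact: sumD.
by apply/step/IHw => s sw; apply: Sw; apply: contraNneq sw => -[->].
Qed.

End SeriesRing.

Arguments ser_cst {F m g} a.
Arguments ser_var {F m g} k.

Section Realization.
Variables (F : fieldType) (g m : nat).

(* ser_expansion p r S: the series S is r(x_1 + p_1, ..., x_g + p_g), inverses
   being taken in the ring A<<x>>. There is such an S, and only one, exactly when p
   lies in the domain of r, because a series is invertible if and only if its
   constant term is. *)
Inductive ser_expansion (p : 'I_g -> 'M[F]_m) :
    rexpr F g -> series F m g -> Prop :=
| ExpConst c : ser_expansion p (RConst c) (ser_cst c%:M)
| ExpVar j : ser_expansion p (RVar j) (ser_var j + ser_cst (p j))
| ExpAdd r1 r2 S1 S2 : ser_expansion p r1 S1 -> ser_expansion p r2 S2 ->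
    ser_expansion p (RAdd r1 r2) (S1 + S2)
| ExpMul r1 r2 S1 S2 : ser_expansion p r1 S1 -> ser_expansion p r2 S2 ->
    ser_expansion p (RMul r1 r2) (S1 * S2)
| ExpInv r1 S T : ser_expansion p r1 S -> S * T = 1 -> T * S = 1 ->
    ser_expansion p (RInv r1) T.

Definition is_realization (n : nat) (r : rexpr F g) (p : 'I_g -> 'M[F]_m)
    (c : 'rV['M[F]_m]_n) (A : 'I_g -> 'M[series F m g]_n)
    (b : 'cV['M[F]_m]_n) : Prop :=
  [/\ rdom p r,
      forall k i j, in_Aw [:: k] (A k i j)
    & exists2 S, ser_expansion p r S &
        forall w : seq 'I_g,
          ser_comp S w =
          (map_mx ser_cst c *m \big[mulmx/1%:M]_(k <- w) A k
             *m map_mx ser_cst b) 0 0].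

End Realization.

(* Main.v *)
Require Import Defs.
From HB Require Import structures.
From mathcomp Require Import all_boot all_order all_algebra.
From mathcomp Require Import boolp.

(** Let S be the expansion of r about p. Everything rests on restricting r to
    curves: a choice Y of s x s matrices, one for each letter (i, k, j), gives
    the line  t |-> p (x) 1 + t X  of tuples of m x m block matrices, the block
    (i, j) of X_k being Y (i, k, j). On such a line r is a matrix of rational
    functions of t with a common denominator, P / d, where d vanishes exactly
    at the t that leave the domain of r ([mxfrac_rdom]). The Taylor expansion
    of P / d at t = 0 has as its coefficients the homogeneous components of S
    evaluated at Y, because substitution is a ring morphism and both P / d and
    S are computed from r by ring operations and inverses
    ([curve_series], [curve_den0]).

    From the vanishing of r to S = 0. Put s = ceil (mn / 2). On every line,
    d P vanishes at all t in the infinite field F, so P = 0 and all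
    homogeneous components of S vanish on s x s matrices. Entrywise these are
    ordinary noncommutative polynomials in m^2 g letters, and such a polynomial
    of degree less than 2s is not an identity of s x s matrices ([homval_inj]).
    As mn <= 2s, all coefficients of S at words of length less than mn are
    zero. Flattening the realization turns it into a linear representation of
    S with scalar matrices of size mn, and a series with a linear
    representation of size D is zero as soon as its coefficients of length
    less than D are ([wordmx_eq0], [realization_eq0]).

    From S = 0 to a rational identity. Let a be a point of the domain of r, in
    any size M. The line that joins p (x) 1 at t = 0 to 1 (x) a at t = 1 has
    P = 0, since S = 0, and d does not vanish at t = 1. Hence 0 is the value
    of r at 1 (x) a, which is the block diagonal matrix of copies of r(a). *)
Set Implicit Arguments.
Unset Strict Implicit.
Unset Printing Implicit Defensive.

Import GRing.Theory.
Local Open Scope ring_scope.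

(** * Evaluation of rational expressions in arbitrary rings *)

(** A relation, because a ring has no total inverse to put in a fixpoint. It
    covers at once matrices over F, series in noncommuting letters and power
    series in one variable, and is transported by every ring morphism. *)
Inductive reval_in (F : Type) (g : nat) (B : pzRingType) (cst : F -> B)
    (q : 'I_g -> B) : rexpr F g -> B -> Prop :=
| EvConst c : reval_in cst q (RConst c) (cst c)
| EvVar j : reval_in cst q (RVar j) (q j)
| EvAdd r1 r2 v1 v2 : reval_in cst q r1 v1 -> reval_in cst q r2 v2 ->
    reval_in cst q (RAdd r1 r2) (v1 + v2)
| EvMul r1 r2 v1 v2 : reval_in cst q r1 v1 -> reval_in cst q r2 v2 ->
    reval_in cst q (RMul r1 r2) (v1 * v2)
| EvInv r1 v1 v : reval_in cst q r1 v1 -> v1 * v = 1 -> v * v1 = 1 ->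
    reval_in cst q (RInv r1) v.

Lemma reval_in_morph (F : Type) (g : nat) (B B' : pzRingType)
    (h : {rmorphism B -> B'}) (cst : F -> B) (cst' : F -> B')
    (q : 'I_g -> B) (q' : 'I_g -> B') (r : rexpr F g) (v : B) :
  h \o cst =1 cst' -> h \o q =1 q' ->
  reval_in cst q r v -> reval_in cst' q' r (h v).
Proof.
move=> hcst hq.
elim=> {r v} [c|j|r1 r2 v1 v2 _ IH1 _ IH2|r1 r2 v1 v2 _ IH1 _ IH2|].
- by rewrite -[h _]/((h \o cst) c) hcst; constructor.
- by rewrite -[h _]/((h \o q) j) hq; constructor.
- by rewrite rmorphD; constructor.
- by rewrite rmorphM; constructor.
move=> r1 v1 v _ IH v1v vv1.
by apply: EvInv IH _ _; rewrite -rmorphM ?v1v ?vv1 rmorph1.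
Qed.

(** Needed because the image of a central scalar under a morphism need not be
    central in the target: it commutes only with what the generators produce. *)
Lemma reval_in_comm (F : Type) (g : nat) (B : pzRingType) (cst : F -> B)
    (q : 'I_g -> B) (z : B) (r : rexpr F g) (v : B) :
  (forall c, GRing.comm z (cst c)) -> (forall j, GRing.comm z (q j)) ->
  reval_in cst q r v -> GRing.comm z v.
Proof.
move=> zcst zq.
elim=> {r v} [//|//|r1 r2 v1 v2 _ IH1 _ IH2|r1 r2 v1 v2 _ IH1 _ IH2|].
- exact: commrD.
- exact: commrM.
move=> r1 v1 v _ zv1 v1v vv1; rewrite /GRing.comm.
by rewrite -[LHS]mul1r -vv1 -mulrA (mulrA v1) -zv1 -(mulrA z) v1v mulr1.
Qed.

Section MatrixValues.
Variables (F : fieldType) (g N : nat).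
Implicit Types (r : rexpr F g) (a : 'I_g -> 'M[F]_N) (v : 'M[F]_N).

Lemma reval_in_rdom a r v :
  reval_in (@scalar_mx F N) a r v -> rdom a r /\ v = reval a r.
Proof.
elim=> {r v} [||r1 r2 v1 v2|r1 r2 v1 v2|r1 v1 v] //=.
- by move=> _ [-> ->] _ [-> ->].
- by move=> _ [-> ->] _ [-> ->].
move=> _ [-> <-] v1v _ /=; have [v1U _] := mulmx1_unit v1v.
by split=> //; rewrite -[LHS]mul1mx -(mulVmx v1U) -mulmxA [v1 *m v]v1v mulmx1.
Qed.

Lemma reval_in_reval a r :
  rdom a r -> reval_in (@scalar_mx F N) a r (reval a r).
Proof.
elim: r => [c|j|r1 IH1 r2 IH2|r1 IH1 r2 IH2|r1 IH1] /=.
- by constructor.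
- by constructor.
- by case/andP=> /IH1 ? /IH2 ?; constructor.
- by case/andP=> /IH1 ? /IH2 ?; apply: EvMul.
case/andP=> /IH1 ev1 U.
by apply: EvInv ev1 _ _; [apply: mulmxV | apply: mulVmx].
Qed.

End MatrixValues.

Lemma ser_expansion_reval_in (F : fieldType) (g m : nat)
    (p : 'I_g -> 'M[F]_m) (r : rexpr F g) (S : series F m g) :
  ser_expansion p r S ->
  reval_in (fun c => ser_cst c%:M) (fun j => ser_var j + ser_cst (p j)) r S.
Proof.
elim=> {r S}.
- by move=> c; apply: (@EvConst _ _ _ (fun c => ser_cst c%:M)).
- by move=> j; apply: (@EvVar _ _ _ _ (fun j => ser_var j + ser_cst (p j))).
- by move=> *; apply: EvAdd.
- by move=> *; apply: EvMul.
by move=> r1 S T _ IH ST TS; apply: EvInv IH ST TS.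
Qed.

(** * Common denominators along a polynomial curve of matrices *)

Section Fraction.
Variables (F : fieldType) (g N : nat) (q : 'I_g -> 'M[{poly F}]_N).

Fixpoint mxfrac (r : rexpr F g) : 'M[{poly F}]_N * {poly F} :=
  match r with
  | RConst c => (c%:P%:M, 1)
  | RVar j => (q j, 1)
  | RAdd r1 r2 => let: (P1, d1) := mxfrac r1 in let: (P2, d2) := mxfrac r2 in
      (d2%:M * P1 + d1%:M * P2, d1 * d2)
  | RMul r1 r2 => let: (P1, d1) := mxfrac r1 in let: (P2, d2) := mxfrac r2 in
      (P1 * P2, d1 * d2)
  | RInv r1 => let: (P1, d1) := mxfrac r1 in
      (d1%:M * (\adj P1 * d1%:M), d1 * \det P1)
  end.

(** The pair (P, d) is built from ring operations, determinants and adjugates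
    only, so d r = P holds wherever the polynomial matrices can be mapped:
    at a value of t as well as in power series of t. For an inverse, from
    d1 v1 = P1 and v1 v = 1 one gets P1 v = d1, hence det P1 v = adj P1 d1; the
    extra factor d1 keeps the zeros of d1 among those of the denominator. *)
Lemma mxfracE (B : pzRingType) (h : {rmorphism 'M[{poly F}]_N -> B})
    (r : rexpr F g) (v : B) :
  reval_in (fun c => h c%:P%:M) (h \o q) r v ->
  h (mxfrac r).2%:M * v = h (mxfrac r).1.
Proof.
have dcomm (d : {poly F}) r' v' :
    reval_in (fun c => h c%:P%:M) (h \o q) r' v' -> GRing.comm (h d%:M) v'.
  apply: reval_in_comm => [c|j]; rewrite /GRing.comm -rmorphM -[RHS]rmorphM;
    by congr (h _); apply/esym/scalar_mxC.
elim=> {r v} [c|j|r1 r2 v1 v2|r1 r2 v1 v2|r1 v1 v].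
- by rewrite /= rmorph1 mul1r.
- by rewrite /= rmorph1 mul1r.
- move=> _ + _ /=; case: (mxfrac r1) (mxfrac r2) => [P1 d1] [P2 d2] /= IH1 IH2.
  have dd : h d1%:M * h d2%:M = h d2%:M * h d1%:M.
    by rewrite -rmorphM -[RHS]rmorphM; congr (h _); apply/esym/scalar_mxC.
  by rewrite rmorphD !rmorphM mulrDr -IH1 -IH2 !mulrA -dd.
- move=> ev1 + _ /=.
  case: (mxfrac r1) (mxfrac r2) => [P1 d1] [P2 d2] /= IH1 IH2.
  rewrite !rmorphM -IH1 -IH2 -mulrA (mulrA (h d2%:M)) (dcomm _ _ _ ev1).
  by rewrite !mulrA.
move=> ev1 /=; case: (mxfrac r1) => [P1 d1] /= IH1 v1v _.
rewrite !rmorphM -mulrA; congr (_ * _).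
rewrite -[in h (\det P1)%:M]mul_adj_mx (rmorphM h) -mulrA -IH1 -mulrA v1v mulr1.
by [].
Qed.

Definition mxat (t : F) (P : 'M[{poly F}]_N) : 'M[F]_N :=
  map_mx (horner_eval t) P.

Lemma mxat_reval (r : rexpr F g) (t : F) : rdom (fun j => mxat t (q j)) r ->
  (mxfrac r).2.[t] *: reval (fun j => mxat t (q j)) r = mxat t (mxfrac r).1.
Proof.
move=> /reval_in_reval ev; rewrite -mul_scalar_mx -[_.[t]]/(horner_eval t _).
rewrite -map_scalar_mx; apply: (@mxfracE _ (map_mx (horner_eval t))).
have -> // : (fun c => map_mx (horner_eval t) c%:P%:M) = @scalar_mx F N.
apply: funext => c.
by rewrite (map_scalar_mx (horner_eval t)) /= /horner_eval hornerC.
Qed.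

(** The only new condition at an inverse is that the value P1 / d1 be
    invertible, that is det P1 <> 0: this is the factor put into d there. *)
Lemma mxfrac_rdom (r : rexpr F g) (t : F) :
  ((mxfrac r).2.[t] != 0) = rdom (fun j => mxat t (q j)) r.
Proof.
elim: r => [c|j|r1 + r2 +|r1 + r2 +|r1] /=;
  try by rewrite -polyC1 hornerC oner_neq0.
- case: (mxfrac r1) (mxfrac r2) => [P1 d1] [P2 d2] /= <- <-.
  by rewrite hornerM mulf_eq0 negb_or.
- case: (mxfrac r1) (mxfrac r2) => [P1 d1] [P2 d2] /= <- <-.
  by rewrite hornerM mulf_eq0 negb_or.
have := @mxat_reval r1 t; case: (mxfrac r1) => [P1 d1] /= + domE.
rewrite -domE hornerM mulf_eq0 negb_or; case: eqP => //= /eqP d1t /(_ isT) P1t.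
rewrite unitmxE unitfE -[in LHS]/(horner_eval t _) -det_map_mx.
rewrite -/(mxat t P1) -P1t detZ.
by rewrite mulf_eq0 expf_eq0 (negPf d1t) andbF.
Qed.

End Fraction.

(** * Power series in one central variable *)

Section PowerSeries.
Variables (F : fieldType) (N : nat).
Implicit Types (P Q : 'M[{poly F}]_N) (s : gword N 1).

(** Matrix power series in a central variable t sit inside [series F N 1] as the
    series whose coefficient at a word depends on its length only: t is the sum
    of all the letters. *)
Definition ser_of_mxpoly P : series F N 1 :=
  Series (fun s => map_mx (coefp (size s)) P).

Lemma ser_of_mxpoly_is_zmod_morphism : zmod_morphism ser_of_mxpoly.
Proof. by move=> P Q; apply: seriesP => s; apply: map_mxB. Qed.

Lemma ser_of_mxpoly_is_monoid_morphism : monoid_morphism ser_of_mxpoly.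
Proof.
split=> [|P Q]; apply: seriesP => s.
  apply/matrixP=> i j; rewrite mxE [X in coefp _ X]mxE /= coefMn coef1.
  by case: s => [|y s] /=; rewrite !mxE // mul0rn.
apply/matrixP => i j; rewrite [LHS]mxE [X in coefp _ X]mxE /= coef_sum summxE.
under [RHS]eq_bigr => a _ do rewrite mxE.
rewrite exchange_big; apply: eq_bigr => k _; rewrite coefM.
apply: eq_bigr => a _.
by rewrite !mxE size_drop size_takel // -ltnS.
Qed.

HB.instance Definition _ := GRing.isZmodMorphism.Build
  'M[{poly F}]_N (series F N 1) ser_of_mxpoly ser_of_mxpoly_is_zmod_morphism.
HB.instance Definition _ := GRing.isMonoidMorphism.Build
  'M[{poly F}]_N (series F N 1) ser_of_mxpoly ser_of_mxpoly_is_monoid_morphism.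

Lemma ser_of_mxpoly_inj : (0 < N)%N -> injective ser_of_mxpoly.
Proof.
move=> N0 P Q PQ; apply/matrixP => i j; apply/polyP => l.
have := congr1 (fun S : series F N 1 => S (nseq l (i, ord0, j)) i j) PQ.
by rewrite /= !mxE size_nseq.
Qed.

(** A scalar power series with nonzero constant term can be cancelled: the
    coefficients of S vanish one after the other, by increasing length. *)
Lemma ser_of_mxpoly_lreg (d : {poly F}) (S : series F N 1) :
  d.[0] != 0 -> ser_of_mxpoly d%:M * S = 0 -> S = 0.
Proof.
rewrite horner_coef0 => d0 dS; apply: seriesP => s; rewrite ser_coef0.
have [l] := ubnP (size s); elim: l s => // l IH s; rewrite ltnS => sl.
have := congr1 (fun T : series F N 1 => T s) dS; rewrite ser_coef0.
rewrite -[LHS]/(\sum_(k < (size s).+1) _) big_ord_recl take0 drop0.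
rewrite big1 => [|k _].
  rewrite addr0 -[ser_of_mxpoly _ _]/(map_mx (coefp 0) _) map_scalar_mx.
  by rewrite mul_scalar_mx => /eqP; rewrite scaler_eq0 (negPf d0) => /eqP.
case: s sl k => [|y s] sl k; first by case: k.
by rewrite IH ?mulmx0 //= size_drop (leq_trans _ sl) // ltnS leq_subr.
Qed.

Definition ser_coef0_mx (S : series F N 1) : 'M[F]_N := S [::].

Lemma ser_coef0_mx_is_zmod_morphism : zmod_morphism ser_coef0_mx.
Proof. by []. Qed.

Lemma ser_coef0_mx_is_monoid_morphism : monoid_morphism ser_coef0_mx.
Proof. by split=> // S T; apply: ser_mul_nil. Qed.

HB.instance Definition _ := GRing.isZmodMorphism.Build
  (series F N 1) 'M[F]_N ser_coef0_mx ser_coef0_mx_is_zmod_morphism.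
HB.instance Definition _ := GRing.isMonoidMorphism.Build
  (series F N 1) 'M[F]_N ser_coef0_mx ser_coef0_mx_is_monoid_morphism.

End PowerSeries.

(** * Evaluation of homogeneous components *)

Section HomogeneousValue.
Variables (F : fieldType) (L : finType) (s : nat) (Y : L -> 'M[F]_s).
Implicit Types (f h : seq L -> F) (l : nat).

(** The component of degree l of the noncommutative polynomial with
    coefficients f, at the tuple Y: the sum of f v times the product of Y along
    v, over the words v of length l. *)
Fixpoint homval l f : 'M[F]_s :=
  if l is l'.+1 then \sum_y Y y *m homval l' (fun v => f (y :: v))
  else (f [::])%:M.

Lemma homvalD l f h : homval l (fun v => f v + h v) = homval l f + homval l h.
Proof.
elim: l f h => [|l IH] f h /=; first exact: raddfD.
by rewrite -big_split /=; apply: eq_bigr => y _; rewrite -mulmxDr -IH.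
Qed.

Lemma homvalZ l a f : homval l (fun v => a * f v) = a *: homval l f.
Proof.
elim: l f => [|l IH] f /=; first by rewrite scale_scalar_mx.
by rewrite scaler_sumr; apply: eq_bigr => y _; rewrite IH scalemxAr.
Qed.

Lemma homval0 l f : (forall v, size v = l -> f v = 0) -> homval l f = 0.
Proof.
elim: l f => [|l IH] f f0 /=; first by rewrite f0 // raddf0.
by rewrite big1 // => y _; rewrite IH ?mulmx0 // => v vl; rewrite f0 //= vl.
Qed.

Lemma homvalB l f h : homval l (fun v => f v - h v) = homval l f - homval l h.
Proof.
rewrite -scaleN1r -homvalZ -homvalD; congr homval.
by apply/funext => v; rewrite mulN1r.
Qed.

Lemma homval_sum l (I : finType) (f : I -> seq L -> F) :
  homval l (fun v => \sum_i f i v) = \sum_i homval l (f i).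
Proof.
elim: l f => [|l IH] f /=; first exact: raddf_sum.
rewrite exchange_big /=; apply: eq_bigr => y _.
by rewrite -mulmx_sumr -IH.
Qed.

Definition cauchy f h v :=
  \sum_(k < (size v).+1) f (take k v) * h (drop k v).

(** Evaluation is multiplicative: splitting off the first letter of the word
    splits a Cauchy product into the part where f sees the empty word and the
    Cauchy product of the shift of f. *)
Lemma homval_cauchy l f h :
  homval l (cauchy f h) = \sum_(k < l.+1) homval k f *m homval (l - k) h.
Proof.
elim: l f => [|l IH] f.
  by rewrite /= /cauchy !big_ord1 /= scalar_mxM.
rewrite big_ord_recl /=.
have E y : (fun v => cauchy f h (y :: v)) =
    (fun v => f [::] * h (y :: v) + cauchy (fun u => f (y :: u)) h v).
  by apply/funext => v; rewrite /cauchy big_ord_recl.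
under eq_bigr => y _ do
  rewrite E homvalD homvalZ IH mulmxDr -scalemxAr mulmx_sumr.
rewrite big_split /= mul_scalar_mx scaler_sumr exchange_big /=.
congr (_ + _); apply: eq_bigr => k _; rewrite mulmx_suml subSS.
by apply: eq_bigr => y _; rewrite mulmxA.
Qed.

End HomogeneousValue.

(** * Flattening matrices of matrices *)

Section FlatMatrix.
Variables (R : pzRingType) (s : nat).

Definition flatmx m n (A : 'M['M[R]_s]_(m, n)) :
    'M[R]_(\sum_(i < m) s, \sum_(j < n) s) := \mxblock_(i < m, j < n) A i j.

Lemma flatmxM m n l (A : 'M_(m, n)) (B : 'M_(n, l)) :
  flatmx (A *m B) = flatmx A *m flatmx B.
Proof.
rewrite /flatmx mul_mxblock; apply/eq_mxblockP => i j.
by rewrite mxE.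
Qed.

Lemma flatmxB m n (A B : 'M_(m, n)) : flatmx (A - B) = flatmx A - flatmx B.
Proof.
by rewrite /flatmx -mxblockB; apply/eq_mxblockP => i j; rewrite !mxE.
Qed.

HB.instance Definition _ m n := GRing.isZmodMorphism.Build
  'M['M[R]_s]_(m, n) 'M[R]_(\sum_(i < m) s, \sum_(j < n) s)
  (@flatmx m n) (@flatmxB m n).

Lemma flatmx_scalar m (a : R) : flatmx a%:M%:M = a%:M :> 'M_(\sum_(i < m) s).
Proof.
rewrite -mxdiagZ; apply/eq_mxblockP => i j; rewrite mxE.
by case: eqP => _; rewrite ?conform_mx_id.
Qed.

Lemma flatmx_inj m n : injective (@flatmx m n).
Proof. by move=> A B /eq_mxblockP AB; apply/matrixP. Qed.

End FlatMatrix.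

Lemma map_flatmx (R R' : pzRingType) (h : {additive R -> R'}) s m n
    (A : 'M['M[R]_s]_(m, n)) :
  map_mx h (flatmx A) = flatmx (map_mx (map_mx h) A).
Proof.
apply/mxblockP => i j.
rewrite mxblockK mxE -[A i j](mxblockK (fun i j => A i j)).
by apply/matrixP => x y; rewrite mxE mxE [RHS]mxE [in RHS]mxE.
Qed.

(** * Substitution of matrices in a series *)

Section SeriesValue.
Variables (F : fieldType) (m g s : nat) (Y : 'I_m * 'I_g * 'I_m -> 'M[F]_s).
Local Notation N := (\sum_(i < m) s)%N.
Implicit Types S T : series F m g.

Definition homval_mx l S : 'M['M[F]_s]_m :=
  \matrix_(i, j) homval Y l (fun v => S v i j).

(** The substitution  x_k = t X_k,  with (i, j)-block of X_k equal to
    Y (i, k, j), as a power series in t: the letter (i, k, j) stands for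
    E_(i,i) x_k E_(j,j). *)
Definition ser_val S : series F N 1 :=
  Series (fun w => flatmx (homval_mx (size w) S)).

Lemma ser_val_is_zmod_morphism : zmod_morphism ser_val.
Proof.
move=> S T; apply: seriesP => w; rewrite -[RHS]/(_ - _) -flatmxB; congr flatmx.
apply/matrixP => i j; rewrite !mxE -homvalB; congr homval.
by apply/funext => v; rewrite !mxE.
Qed.

Lemma homval_mx_cst l a :
  homval_mx l (ser_cst a) = if l is 0 then map_mx (@scalar_mx F s) a else 0.
Proof.
case: l => [|l]; apply/matrixP => i j; rewrite !mxE //.
by rewrite homval0 // => -[|y v] // _; rewrite mxE.
Qed.

Lemma ser_val_scalar (a : F) : ser_val (ser_cst a%:M) = ser_of_mxpoly a%:P%:M.
Proof.
apply: seriesP => w; rewrite /= homval_mx_cst.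
apply/matrixP => x y; rewrite [RHS]mxE [in RHS]mxE /= coefMn coefC.
case: (size w) => [|l]; last by rewrite raddf0 mxE mul0rn.
by rewrite map_scalar_mx flatmx_scalar mxE.
Qed.

Lemma homval_mx_var l k : homval_mx l (ser_var k) =
  if l is 1 then \matrix_(i, j) Y (i, k, j) else 0.
Proof.
case: l => [|[|l]]; apply/matrixP => i j; rewrite mxE; last 1 first.
- by rewrite mxE homval0 // => -[|[[x k'] y] [|z v]] // _; rewrite mxE.
- by rewrite /= !mxE raddf0.
rewrite mxE /= (bigD1 (i, k, j)) //= eqxx mxE !eqxx mulmx1 big1 ?addr0 //.
move=> [[i' k'] j'] ne; rewrite /=.
have [kk|_] := eqVneq k' k; last by rewrite mxE raddf0 mulmx0.
rewrite mxE (_ : _ && _ = false) ?raddf0 ?mulmx0 //.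
by apply: contraNF ne => /andP[/eqP-> /eqP->]; rewrite kk.
Qed.

Lemma homval_mxM l S T : homval_mx l (S * T) =
  \sum_(k < l.+1) homval_mx k S *m homval_mx (l - k) T.
Proof.
apply/matrixP => i j; rewrite mxE summxE.
have -> : (fun v => (S * T) v i j) = (fun v =>
    \sum_k cauchy (fun u => S u i k) (fun u => T u k j) v).
  apply/funext => v; rewrite -[(S * T) v]/(\sum_(k < (size v).+1) _) summxE.
  by rewrite exchange_big; apply: eq_bigr => k _; rewrite mxE.
rewrite homval_sum; under eq_bigr => k _ do rewrite homval_cauchy.
rewrite exchange_big; apply: eq_bigr => k _; rewrite mxE.
by apply: eq_bigr => x _; rewrite !mxE.
Qed.

Lemma ser_val_is_monoid_morphism : monoid_morphism ser_val.
Proof.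
split=> [|S T]; apply: seriesP => w.
  rewrite -[LHS]/(flatmx (homval_mx (size w) (ser_cst 1%:M))) homval_mx_cst.
  case: w => [|y w] /=; last by rewrite raddf0.
  by rewrite map_scalar_mx flatmx_scalar.
rewrite -[RHS]/(\sum_(k < (size w).+1) _) /= homval_mxM raddf_sum.
apply: eq_bigr => k _ /=.
by rewrite flatmxM size_drop size_takel // -ltnS.
Qed.

HB.instance Definition _ := GRing.isZmodMorphism.Build
  (series F m g) (series F N 1) ser_val ser_val_is_zmod_morphism.
HB.instance Definition _ := GRing.isMonoidMorphism.Build
  (series F m g) (series F N 1) ser_val ser_val_is_monoid_morphism.

Lemma ser_val_eq0 S l : (0 < N)%N -> ser_val S = 0 -> homval_mx l S = 0.
Proof.
move=> N0 S0; apply: (@flatmx_inj _ s m m); rewrite raddf0.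
pose y : 'I_N * 'I_1 * 'I_N := (Ordinal N0, ord0, Ordinal N0).
have := congr1 (fun T : series F N 1 => T (nseq l y)) S0.
by rewrite ser_coef0 /= size_nseq.
Qed.

(** The line  p (x) 1 + t X  of the tuple X with blocks Y (i, k, j). *)
Definition mxcurve (p : 'I_g -> 'M[F]_m) (k : 'I_g) : 'M[{poly F}]_N :=
  flatmx (\matrix_(i, j)
    ((p k i j)%:P%:M + 'X *: map_mx polyC (Y (i, k, j)))).

Lemma ser_of_mxcurve p k :
  ser_of_mxpoly (mxcurve p k) = ser_val (ser_var k + ser_cst (p k)).
Proof.
rewrite rmorphD; apply: seriesP => w /=.
rewrite homval_mx_cst homval_mx_var -raddfD (map_flatmx (coefp _)).
congr flatmx.
apply/matrixP => i j; apply/matrixP => x y.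
case: (size w) => [|[|l]];
  rewrite !mxE /= coefD coefMn coefC /= mulrC coefMX /=.
- by rewrite addr0 add0r.
- by rewrite mul0rn add0r addr0 coefC.
- by rewrite mul0rn !add0r coefC.
Qed.

End SeriesValue.

(** * Matrices of size s satisfy no polynomial identity of degree below 2s *)

Lemma poly_vanish_eq0 (F : fieldType) (p : {poly F}) :
  [pchar F] =i pred0 -> (forall t, p.[t] = 0) -> p = 0.
Proof.
move=> F0 p0; apply/eqP/negPn/negP => pn0.
pose rs := [seq (i%:R : F) | i <- iota 0 (size p)].
have := @max_poly_roots _ p rs pn0; rewrite size_map size_iota ltnn => H.
suff : false by []; apply: H; first by apply/allP => x _; rewrite rootE p0.
rewrite map_inj_in_uniq ?iota_uniq // => i j _ _.
wlog ij : i j / (i <= j)%N => [W E|].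
  by case/orP: (leq_total i j) => ij; [exact: W | apply/esym/W].
move/eqP; rewrite eq_sym -subr_eq0 -natrB // => /eqP E.
by apply/eqP; rewrite eqn_leq ij -subn_eq0 -((pcharf0P F).1 F0) E eqxx.
Qed.

Section PolynomialIdentity.
Variables (F : fieldType) (L : finType).
Implicit Types f : seq L -> F.

(** The letter a moves along a loop of weight x at the new first basis vector
    and b leads from it into the old space. The upper right block collects
    the words a^k b v by powers of x. *)
Lemma homval_block s (a b : L) (x : F) (u : 'rV[F]_s) (Y : L -> 'M[F]_s) l f
    (Z := fun y => block_mx (x *+ (y == a))%:M (u *+ (y == b)) 0 (Y y)
            : 'M[F]_(1 + s)) :
  drsubmx (homval Z l f) = homval Y l f /\
  ursubmx (homval Z l f) = \sum_(k < l)
    x ^+ k *: (u *m homval Y (l - k.+1) (fun v => f (nseq k a ++ b :: v))).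
Proof.
elim: l f => [|l IH] f /=.
  by rewrite big_ord0 (scalar_mx_block 1 s) block_mxKdr block_mxKur.
have drS (M : L -> 'M[F]_(1 + s)) : drsubmx (\sum_y M y) = \sum_y drsubmx (M y).
  by rewrite /drsubmx !raddf_sum.
have urS (M : L -> 'M[F]_(1 + s)) : ursubmx (\sum_y M y) = \sum_y ursubmx (M y).
  by rewrite /ursubmx !raddf_sum.
rewrite drS urS; split.
  apply: eq_bigr => y _; have [<- _] := IH (fun v => f (y :: v)).
  rewrite -[in LHS](submxK (homval _ _ _)) mulmx_block block_mxKdr.
  by rewrite mul0mx add0r.
have E y : ursubmx (Z y *m homval Z l (fun v => f (y :: v))) =
    (x *: ursubmx (homval Z l (fun v => f (a :: v)))) *+ (y == a)
    + (u *m homval Y l (fun v => f (b :: v))) *+ (y == b).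
  have [<- _] := IH (fun v => f (b :: v)).
  rewrite -[in LHS](submxK (homval _ _ _)) mulmx_block block_mxKur.
  congr (_ + _).
    by rewrite mul_scalar_mx; case: eqP => [->|]; rewrite ?scale0r.
  by case: eqP => [->|]; rewrite // mul0mx.
rewrite (eq_bigr _ (fun y _ => E y)).
rewrite big_split /= addrC big_ord_recl /= expr0 scale1r subn1 /=.
congr (_ + _); first by rewrite (bigD1 b) //= eqxx big1 ?addr0 // => y /negPf->.
rewrite (bigD1 a) //= eqxx big1 ?addr0 // => [|y /negPf->] //.
rewrite (IH _).2 scaler_sumr; apply: eq_bigr => k _.
by rewrite scalerA -exprS subSS.
Qed.

(** Each additional dimension reads off two letters: with the block matrices of
    [homval_block], the coefficient of x^1 is the value on (s - 1) x (s - 1)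
    matrices of the polynomial with coefficients f (a b v), of degree l - 2.
    This is what makes the bound 2s, rather than s, attainable. *)
Lemma homval_inj s l f : [pchar F] =i pred0 -> (l < s.*2)%N ->
  (forall Y : L -> 'M[F]_s, homval Y l f = 0) ->
  forall v, size v = l -> f v = 0.
Proof.
move=> F0; elim: s l f => // s IH [|[|l]] f ls f0.
- move=> [|//] _; have /matrixP/(_ 0 0) := f0 (fun=> 0).
  by rewrite /= !mxE mulr1n.
- move=> [|a [|//]] // _; have /matrixP/(_ 0 0) := f0 (fun y => (y == a)%:R%:M).
  rewrite /= (bigD1 a) //= eqxx big1 => [|y /negPf->]; last first.
    by rewrite raddf0 mul0mx.
  by rewrite addr0 mul1mx !mxE mulr1n.
move=> [|a [|b v]] // [vl]; apply: (IH l (fun v => f [:: a, b & v])) vl => // Y.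
apply/row_matrixP => i; rewrite row0 rowE; apply/rowP => j.
pose E (k : nat) : F := ((delta_mx 0 i : 'rV_s) *m
  homval Y (l.+2 - k.+1) (fun v => f (nseq k a ++ b :: v))) 0 j.
(* E k is the coefficient of x ^+ k; k = 1 is the wanted one. *)
suff : \poly_(k < l.+2) E k = 0.
  move/(congr1 (fun p : {poly F} => p`_1)).
  by rewrite coef_poly coef0 /E subn2 /= => ->; rewrite mxE.
apply: poly_vanish_eq0 => // x; rewrite horner_poly.
have [_] := homval_block a b x (delta_mx 0 i) Y l.+2 f.
rewrite f0 /ursubmx !raddf0 => /matrixP/(_ 0 j).
rewrite mxE summxE => E0; rewrite [RHS]E0.
by apply: eq_bigr => k _; rewrite [RHS]mxE mulrC.
Qed.

End PolynomialIdentity.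

(** * Series with a linear representation *)

Section LinearRepresentation.
Variables (F : fieldType) (L : finType) (d e : nat).
Variables (T : L -> 'M[F]_d) (c : 'M[F]_(e, d)).

Definition wordmx (v : seq L) : 'M[F]_d := \prod_(y <- v) T y.

Lemma wordmx_nil : wordmx [::] = 1%:M. Proof. exact: big_nil. Qed.

Lemma wordmx_cons y v : wordmx (y :: v) = T y *m wordmx v.
Proof. exact: big_cons. Qed.

Lemma wordmx_rcons v y : wordmx (rcons v y) = wordmx v *m T y.
Proof. exact: big_rcons. Qed.

(** The row space of [reach k] is the sum of those of c *m wordmx v, over the
    words v of length at most k. *)
Fixpoint reach (k : nat) : 'M[F]_d :=
  if k is k'.+1 then (reach k' + \sum_y reach k' *m T y)%MS else <<c>>%MS.

Lemma reach_word v : (c *m wordmx v <= reach (size v))%MS.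
Proof.
elim/last_ind: v => [|v y IH].
  by rewrite wordmx_nil mulmx1 genmxE.
rewrite wordmx_rcons size_rcons mulmxA /=.
apply: submx_trans (addsmxSr _ _); apply: submx_trans (submxMr _ IH) _.
exact: (sumsmx_sup y).
Qed.

Lemma reach_mono j k : (j <= k)%N -> (reach j <= reach k)%MS.
Proof.
move/subnK<-; elim: (k - j)%N => //= l IH.
by apply: submx_trans IH (addsmxSl _ _).
Qed.

Lemma reach_annihilated f k (b : 'M[F]_(d, f)) :
  (forall v, (size v <= k)%N -> c *m wordmx v *m b = 0) -> reach k *m b = 0.
Proof.
elim: k f b => [|k IH] f b cb.
  apply/sub_kermxP; rewrite /= genmxE; apply/sub_kermxP.
  by have := cb [::] isT; rewrite wordmx_nil mulmx1.
apply/sub_kermxP; rewrite /= addsmx_sub; apply/andP; split.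
  by apply/sub_kermxP/IH => v vk; apply/cb/leqW.
apply/sumsmx_subP => y _; apply/sub_kermxP; rewrite -mulmxA.
apply: IH => v vk; have := cb (rcons v y); rewrite size_rcons ltnS => /(_ vk).
by rewrite wordmx_rcons !mulmxA.
Qed.

Lemma reach_stable k j :
  (reach k.+1 <= reach k)%MS -> (reach j <= reach k)%MS.
Proof.
move=> st; have [jk|/ltnW kj] := leqP j k; first exact: reach_mono.
rewrite -(subnK kj); elim: (j - k)%N => //= l IH.
rewrite addsmx_sub IH; apply/sumsmx_subP => y _.
apply: submx_trans (submxMr _ IH) _; apply: submx_trans st => /=.
by apply: submx_trans (addsmxSr _ _); apply: (sumsmx_sup y).
Qed.

(** The chain of reachable spaces gains a dimension at each step until it
    stops growing. *)
Lemma reach_rank k : c != 0 ->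
  (k < \rank (reach k))%N \/ (reach k.+1 <= reach k)%MS.
Proof.
move=> c0; elim: k => [|k [IH|IH]].
- by left; rewrite /= genmxE lt0n mxrank_eq0.
- case: (boolP (reach k.+1 <= reach k)%MS) => st.
    by right; apply: submx_trans (reach_stable _ st) (reach_mono (leqnSn k)).
  left; apply: leq_ltn_trans IH _; apply: rank_ltmx.
  by rewrite ltmxE (reach_mono (leqnSn k)).
by right; apply: submx_trans (reach_stable _ IH) (reach_mono (leqnSn k)).
Qed.

(** The reachable space is exhausted by words of length less than d, so that b
    annihilates all of it once it annihilates these. *)
Lemma wordmx_eq0 f (b : 'M[F]_(d, f)) :
  (forall v, (size v < d)%N -> c *m wordmx v *m b = 0) ->
  forall v, c *m wordmx v *m b = 0.
Proof.
move=> cb v; have [->|c0] := eqVneq c 0; first by rewrite !mul0mx.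
have d0 : (0 < d)%N.
  by case: (d) (c) c0 => // c'; rewrite thinmx0 eqxx.
have rb : reach d.-1 *m b = 0.
  by apply: reach_annihilated => u ud; apply: cb; rewrite -(prednK d0).
suff /submxP[X ->] : (c *m wordmx v <= reach d.-1)%MS.
  by rewrite -mulmxA rb mulmx0.
apply: submx_trans (reach_word v) _.
have [full|st] := reach_rank d.-1 c0; last exact: reach_stable.
by apply: submx_full; rewrite /row_full eqn_leq rank_leq_col -{1}(prednK d0).
Qed.

End LinearRepresentation.

(** * Flattening a realization *)

Section FlatDiag.
Variables (R : pzRingType) (s m : nat).

(** The block diagonal embedding  A |-> 1 (x) A. *)
Definition flatdiag (A : 'M[R]_s) : 'M[R]_(\sum_(i < m) s) := flatmx A%:M.

Lemma flatdiag_is_zmod_morphism : zmod_morphism flatdiag.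
Proof. by move=> A B; rewrite /flatdiag raddfB raddfB. Qed.

Lemma flatdiag_is_monoid_morphism : monoid_morphism flatdiag.
Proof.
split=> [|A B]; first exact: flatmx_scalar.
by rewrite /flatdiag scalar_mxM flatmxM.
Qed.

HB.instance Definition _ := GRing.isZmodMorphism.Build
  'M[R]_s 'M[R]_(\sum_(i < m) s) flatdiag flatdiag_is_zmod_morphism.
HB.instance Definition _ := GRing.isMonoidMorphism.Build
  'M[R]_s 'M[R]_(\sum_(i < m) s) flatdiag flatdiag_is_monoid_morphism.

Lemma flatdiag_inj : (0 < m)%N -> injective flatdiag.
Proof.
move=> m0 A B /flatmx_inj/matrixP/(_ (Ordinal m0) (Ordinal m0)).
by rewrite !mxE eqxx !mulr1n.
Qed.

End FlatDiag.

Section RealizationCoefficients.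
Variables (F : fieldType) (m g : nat).
Local Notation letter := ('I_m * 'I_g * 'I_m)%type.
Implicit Types S T : series F m g.

Lemma linear_serM k S T (y : letter) v : in_Aw [:: k] S -> y.1.2 = k ->
  (S * T) (y :: v) = S [:: y] *m T v.
Proof.
move=> /in_AwP Sk yk; rewrite -[LHS]/(ser_mul S T (y :: v)) ser_mul_cons.
rewrite (Sk [::]) // mul0mx add0r -ser_mulcl; congr (ser_mul _ _ _).
by apply: seriesP => -[|z u] //=; apply: Sk; rewrite /= eqseq_cons andbF.
Qed.

Variables (n : nat) (c : 'rV['M[F]_m]_n) (A : 'I_g -> 'M[series F m g]_n).
Variable b : 'cV['M[F]_m]_n.
Hypothesis Alin : forall k i j, in_Aw [:: k] (A k i j).

Definition transition (y : letter) : 'M['M[F]_m]_n :=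
  \matrix_(i, j) A y.1.2 i j [:: y].

(** Each entry of A k lives on words of length one, so the coefficient at a word
    of length l of a product of l of them has a single factorization. *)
Lemma realization_word (v : gword m g) i :
  (\big[mulmx/1%:M]_(k <- gletters v) A k *m map_mx ser_cst b) i 0 v =
  ((\prod_(y <- v) transition y) *m b) i 0.
Proof.
elim: v i => [|y v IH] i; first by rewrite !big_nil !mul1mx mxE.
rewrite /= !big_cons -mulmxA mxE ser_coef_sum -[_ * _ *m b]mulmxA [RHS]mxE.
apply: eq_bigr => j _; rewrite (linear_serM _ _ (Alin _ _ _)) // IH.
by congr (_ *m _); rewrite mxE.
Qed.

Lemma realization_coef S :
  (forall w, ser_comp S w =
    (map_mx ser_cst c *m \big[mulmx/1%:M]_(k <- w) A k
       *m map_mx ser_cst b) 0 0) ->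
  forall v, S v = (c *m (\prod_(y <- v) transition y) *m b) 0 0.
Proof.
move=> Sw v; have := congr1 (fun T : series F m g => T v) (Sw (gletters v)).
rewrite /= eqxx => ->; rewrite -!mulmxA 2!mxE ser_coef_sum.
apply: eq_bigr => j _; rewrite -realization_word mxE.
exact: ser_cstMl.
Qed.

Lemma flatmx_prod (v : gword m g) :
  flatmx (\prod_(y <- v) transition y) =
  wordmx (fun y => flatmx (transition y)) v.
Proof.
elim: v => [|y v IH]; first by rewrite big_nil wordmx_nil flatmx_scalar.
by rewrite big_cons wordmx_cons -IH -flatmxM.
Qed.

(** A realization of dimension n over m x m matrices is, once flattened, a
    linear representation with m n states over the base field. *)
Lemma realization_eq0 S :
  (forall w, ser_comp S w =
    (map_mx ser_cst c *m \big[mulmx/1%:M]_(k <- w) A k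
       *m map_mx ser_cst b) 0 0) ->
  (forall v, (size v < m * n)%N -> S v = 0) -> S = 0.
Proof.
move=> Sw S0; have SE := realization_coef Sw.
have flatE v : flatmx (c *m (\prod_(y <- v) transition y) *m b) =
    flatmx c *m wordmx (fun y => flatmx (transition y)) v *m flatmx b.
  by rewrite !flatmxM flatmx_prod.
apply: seriesP => v; rewrite ser_coef0 SE.
suff /(@flatmx_inj F m 1 1)-> :
  flatmx (c *m (\prod_(y <- v) transition y) *m b) = flatmx 0 by rewrite mxE.
rewrite raddf0 flatE; apply: wordmx_eq0 => {}v.
have -> : (size v < \sum_(i < n) m = (size v < m * n))%N.
  by rewrite sum_nat_const card_ord mulnC.
move=> vmn.
rewrite -flatE -[RHS](raddf0 (@flatmx F m 1 1)); congr flatmx.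
by apply/matrixP => i j; rewrite !ord1 -SE S0 // mxE.
Qed.

End RealizationCoefficients.

(** * Restriction of a rational expression to a line *)

Section Curve.
Variables (F : fieldType) (g m s : nat) (r : rexpr F g).
Variables (p : 'I_g -> 'M[F]_m) (S : series F m g).
Variable Y : 'I_m * 'I_g * 'I_m -> 'M[F]_s.
Hypothesis expS : ser_expansion p r S.
Local Notation N := (\sum_(i < m) s)%N.
Local Notation q := (mxcurve Y p).

Lemma curve_reval_in : reval_in (fun a => ser_of_mxpoly a%:P%:M)
  (@ser_of_mxpoly F N \o q) r (ser_val Y S).
Proof.
apply: reval_in_morph (ser_expansion_reval_in expS) => [a|k] /=.
  exact: ser_val_scalar.
by rewrite ser_of_mxcurve.
Qed.

(** The expansion of P / d at t = 0 is the value of S on the line. *)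
Lemma curve_series :
  ser_of_mxpoly (mxfrac q r).2%:M * ser_val Y S = ser_of_mxpoly (mxfrac q r).1.
Proof. exact: mxfracE curve_reval_in. Qed.

(** The constant term of S is the value of r at p (x) 1, which therefore lies in
    the domain of r. *)
Lemma curve_den0 : (mxfrac q r).2.[0] != 0.
Proof.
have mxat0 P : ser_coef0_mx (ser_of_mxpoly P) = mxat 0 P :> 'M[F]_N.
  by apply/matrixP => i j; rewrite !mxE /= /horner_eval horner_coef0.
rewrite mxfrac_rdom; apply: (proj1 (reval_in_rdom (v := ser_coef0_mx _) _)).
apply: reval_in_morph curve_reval_in => [a|k]; last exact: mxat0.
by rewrite [LHS]mxat0 /mxat map_scalar_mx /= /horner_eval hornerC.
Qed.

End Curve.

(** * Vanishing in one size implies vanishing everywhere *)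

Theorem theorem6p1 (F : fieldType) (g m n : nat) (r : rexpr F g) :
  [pchar F] =i pred0 ->
  (0 < m)%N ->
  (exists (p : 'I_g -> 'M[F]_m) (c : 'rV['M[F]_m]_n)
          (A : 'I_g -> 'M[series F m g]_n) (b : 'cV['M[F]_m]_n),
     is_realization r p c A b) ->
  (forall a : 'I_g -> 'M[F]_(m * uphalf (m * n)), rdom a r -> reval a r = 0) ->
  rational_identity r.
Proof.
move=> F0 m0 [p [c [A [b [pdom Alin [S expS Sw]]]]]] van.
have N0 s : (0 < s)%N -> (0 < \sum_(i < m) s)%N.
  by move=> s0; rewrite sum_nat_const card_ord muln_gt0 m0.
have S0 : S = 0.
  apply: realization_eq0 Alin _ Sw _ => v vmn.
  move: van; have -> : (m * uphalf (m * n) = \sum_(i < m) uphalf (m * n))%N.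
    by rewrite sum_nat_const card_ord.
  set s := uphalf (m * n) => van.
  have vs : (size v < s.*2)%N by rewrite (leq_trans vmn) // -leq_uphalf_double.
  apply/matrixP => i j; rewrite mxE.
  apply: (homval_inj (f := fun v => S v i j) F0 vs) (erefl _) => Y.
  pose q := mxcurve Y p; have d0 := curve_den0 Y expS.
  have P0 : (mxfrac q r).1 = 0.
    apply/matrixP => x y; rewrite mxE.
    (* The factor d makes the product vanish also where the line leaves the
       domain of r. *)
    suff : (mxfrac q r).2 * (mxfrac q r).1 x y = 0.
      move/eqP; rewrite mulf_eq0 => /orP[/eqP E|/eqP //].
      by move: d0; rewrite E horner0 eqxx.
    apply: poly_vanish_eq0 => // t; rewrite hornerM.
    have [->|dt] := eqVneq (mxfrac q r).2.[t] 0; first by rewrite mul0r.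
    move: dt; rewrite mxfrac_rdom => dom; have := mxat_reval dom.
    rewrite van // scaler0 => /matrixP/(_ x y).
    by rewrite !mxE /horner_eval => <-; rewrite mulr0.
  have := curve_series Y expS; rewrite P0 raddf0.
  move/(ser_of_mxpoly_lreg d0)/(ser_val_eq0 (size v)) => /(_ _)/matrixP/(_ i j).
  by rewrite !mxE; apply; rewrite N0 // -double_gt0 (leq_ltn_trans _ vs).
split; first by exists m; split=> //; exists p.
move=> M a M0 adom.
(* The blocks of 1 (x) a - p (x) 1. *)
pose Y (y : 'I_m * 'I_g * 'I_m) : 'M[F]_M :=
  a y.1.2 *+ (y.1.1 == y.2) - (p y.1.2 y.1.1 y.2)%:M.
pose q := mxcurve Y p; have := curve_series Y expS; rewrite S0 raddf0 mulr0.
rewrite -(raddf0 (@ser_of_mxpoly F _)) => /(ser_of_mxpoly_inj (N0 _ M0)) P0.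
have q1 k : mxat 1 (q k) = flatdiag m (a k).
  rewrite /mxat map_flatmx; congr flatmx; apply/matrixP => i j.
  apply/matrixP => x y; rewrite !mxE /= /horner_eval hornerD hornerMn hornerC.
  by rewrite mulrC hornerMX hornerC mulr1 /Y [LHS]addrC subrK.
have [dom ev] : rdom (fun k => mxat 1 (q k)) r /\
    flatdiag m (reval a r) = reval (fun k => mxat 1 (q k)) r.
  apply: reval_in_rdom; apply: reval_in_morph (reval_in_reval adom) => [x|k] /=.
    exact: flatmx_scalar.
  by rewrite q1.
have := mxat_reval dom; rewrite -P0 -ev; move: dom; rewrite -mxfrac_rdom => d1.
rewrite [mxat _ _]raddf0 => /eqP; rewrite scaler_eq0 (negPf d1) /= => /eqP.
by rewrite -(raddf0 (@flatdiag F M m)) => /(flatdiag_inj m0).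
Qed.
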